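(* Consider the finite-dimensional linear relaxation family $U_t=L_\varepsilon U$, $L_\varepsilon=A+\frac1\varepsilon B_0$, $0<\varepsilon\le\varepsilon_0$, satisfying the spectral splitting assumption (see context), with base step $S_\varepsilon(h)=S(h;A,B_0/\varepsilon)$ and corrected step $R_{\rm SFRC}(h,\varepsilon)=\Pi_s S_\varepsilon(h)\Pi_s+e^{hL_\varepsilon}\Pi_f$. Fix $\varepsilon\in(0,\varepsilon_0]$. Then $$R_{\rm SFRC}(h,\varepsilon)-S_\varepsilon(h)=O(h^5),\qquad h\to0.$$ Consequently SFRC has ordinary order four, i.e. $R_{\rm SFRC}(h,\varepsilon)-e^{hL_\varepsilon}=O(h^5)$ as $h\to0$ for this fixed $\varepsilon$, and it preserves the base method's mixed expansion through degree four, i.e. the $h$-Taylor operator coefficients of $R_{\rm SFRC}(h,\varepsilon)$ and $S_\varepsilon(h)$ at $h=0$ agree through degree four.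
   Context: Base step. For square matrices $A,B$ (not necessarily commuting), $L=A+B$ and step size $h>0$, define (whenever the inverses exist, in particular for $h$ small) $$P_*=\Bigl(I-\tfrac h2B+\tfrac{h^2}{8}BL\Bigr)^{-1}\Bigl(I+\tfrac h2A+\tfrac{h^2}{8}AL\Bigr),$$ $$S(h;A,B)=\Bigl(I-hB+\tfrac{h^2}{6}BL\Bigr)^{-1}\Bigl[I+hA+\tfrac{h^2}{6}AL+\tfrac{h^2}{3}(A-B)LP_*\Bigr].$$ This is the one-step matrix of a compact two-stage two-derivative IMEX method. Spectral splitting assumption. For every $0<\varepsilon\le\varepsilon_0$ there are complementary projectors $\Pi_s=\Pi_s(\varepsilon)$, $\Pi_f=\Pi_f(\varepsilon)$, independent of $h$, with $I=\Pi_s+\Pi_f$, $\Pi_s\Pi_f=\Pi_f\Pi_s=0$, each commuting with $L_\varepsilon$; $\sup_{0<\varepsilon\le\varepsilon_0}(\|\Pi_s(\varepsilon)\|+\|\Pi_f(\varepsilon)\|)\le C_P<\infty$; and the slow generator $L_s=\Pi_sL_\varepsilon\Pi_s$ satisfies $\sup_{0<\varepsilon\le\varepsilon_0}\|L_s(\varepsilon)\|\le M_L<\infty$. The constant in the $O(h^5)$ statements may depend on the fixed $\varepsilon$. A corrected map is said to preserve the base method's mixed expansion through order four if its difference from the base step, for fixed split operators, is $O(h^5)$, so that the $h$-Taylor operator coefficients agree through degree four. *)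

(* Defs.v *)
From HB Require Import structures.
From mathcomp Require Import all_boot all_order all_algebra.
From mathcomp Require Import all_classical all_reals all_analysis.
From mathcomp Require Import complex.

Set Implicit Arguments.
Unset Strict Implicit.
Unset Printing Implicit Defensive.

Import Order.TTheory GRing.Theory Num.Theory.
Import numFieldNormedType.Exports.

Local Open Scope classical_set_scope.
Local Open Scope ring_scope.

(* Matrices have real or complex entries.  All parameters (step size h, epsilon,
   bounds) live in the scalar field K; over the complex numbers the order of a
   [numFieldType] makes [0 < eps <= eps0] say that eps and eps0 are positive
   reals, and h -> 0 is taken along all complex h, hence in particular along
   positive real step sizes. *)
Variant scalar_kind := RealScalars | ComplexScalars.

Definition scalar_field (R : realType) (k : scalar_kind) : numFieldType :=
  match k with
  | RealScalars => R
  | ComplexScalars => R[i]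
  end.

Section MatrixExponential.
Variables (K : numFieldType) (n : nat).

Definition expmx (A : 'M[K]_n) : 'M[K]_n :=
  limn (series (fun k : nat => (k`!%:R)^-1 *: A ^+ k)).

End MatrixExponential.

Section BaseStep.
Variables (K : numFieldType) (n : nat).
Implicit Types (h eps : K) (A B : 'M[K]_n).

(* [invmx M] is the inverse of M when M is invertible and M otherwise; the two
   matrices inverted below are the identity at h = 0, hence invertible for h
   near 0. *)
Definition Pstar h A B : 'M[K]_n :=
  let L := A + B in
  invmx (1%:M - (h / 2) *: B + (h ^+ 2 / 8) *: (B *m L))
  *m (1%:M + (h / 2) *: A + (h ^+ 2 / 8) *: (A *m L)).

Definition base_step h A B : 'M[K]_n :=
  let L := A + B in
  invmx (1%:M - h *: B + (h ^+ 2 / 6) *: (B *m L))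
  *m (1%:M + h *: A + (h ^+ 2 / 6) *: (A *m L)
      + (h ^+ 2 / 3) *: ((A - B) *m L *m Pstar h A B)).

End BaseStep.

Section Relaxation.
Variables (K : numFieldType) (n : nat).
Implicit Types (A : 'M[K]_n) (Pis Pif : K -> 'M[K]_n) (h eps : K).

Definition relax_gen A (B0 : 'M[K]_n) eps : 'M[K]_n := A + eps^-1 *: B0.

Definition relax_base A (B0 : 'M[K]_n) h eps : 'M[K]_n := base_step h A (eps^-1 *: B0).

Definition R_SFRC A (B0 : 'M[K]_n) Pis Pif h eps : 'M[K]_n :=
  Pis eps *m relax_base A B0 h eps *m Pis eps
  + expmx (h *: relax_gen A B0 eps) *m Pif eps.

(* [`|M|] is the entrywise maximum norm [mx_norm]; in finite dimension the
   existence of the uniform bounds does not depend on the choice of norm. *)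
Record spectral_splitting A (B0 : 'M[K]_n) (eps0 : K) Pis Pif : Prop := SpectralSplitting {
  splitting_sum : forall eps, 0 < eps <= eps0 -> Pis eps + Pif eps = 1%:M;
  splitting_slow_idem : forall eps, 0 < eps <= eps0 ->
    Pis eps *m Pis eps = Pis eps;
  splitting_fast_idem : forall eps, 0 < eps <= eps0 ->
    Pif eps *m Pif eps = Pif eps;
  splitting_sf0 : forall eps, 0 < eps <= eps0 -> Pis eps *m Pif eps = 0;
  splitting_fs0 : forall eps, 0 < eps <= eps0 -> Pif eps *m Pis eps = 0;
  splitting_slow_comm : forall eps, 0 < eps <= eps0 ->
    comm_mx (Pis eps) (relax_gen A B0 eps);
  splitting_fast_comm : forall eps, 0 < eps <= eps0 ->
    comm_mx (Pif eps) (relax_gen A B0 eps);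
  splitting_proj_bound : exists CP : K, forall eps, 0 < eps <= eps0 ->
    `|Pis eps| + `|Pif eps| <= CP;
  splitting_slow_bound : exists ML : K, forall eps, 0 < eps <= eps0 ->
    `|Pis eps *m relax_gen A B0 eps *m Pis eps| <= ML
}.

End Relaxation.

Section Taylor.
Variables (K : numFieldType) (V : normedModType K).
Implicit Types f g : K -> V.

Definition taylor_coef f (k : nat) : V := (k`!%:R)^-1 *: derive1n k f 0.

(* [derive1n] is total; this says that the derivatives up to order N at 0, and
   hence the Taylor coefficients up to degree N, are genuine. *)
Definition has_taylor_coefs f (N : nat) : Prop :=
  forall k, (k < N)%N -> \forall h \near (0 : K), derivable (derive1n k f) h 1.

Definition taylor_agree f g (N : nat) : Prop :=
  [/\ has_taylor_coefs f N, has_taylor_coefs g N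
    & forall k, (k <= N)%N -> taylor_coef f k = taylor_coef g k].

End Taylor.

(* Main.v *)
Require Import Defs.
From HB Require Import structures.
From mathcomp Require Import all_boot all_order all_algebra.
From mathcomp Require Import all_classical all_reals all_analysis.
From mathcomp Require Import complex.
From mathcomp Require Import ring.
Import Order.TTheory GRing.Theory Num.Theory.
Import numFieldNormedType.Exports.
Local Open Scope classical_set_scope.
Local Open Scope ring_scope.

Set Implicit Arguments.
Unset Strict Implicit.
Unset Printing Implicit Defensive.

(** Write L for the relaxation generator, E for its exponential, S for the base
step and R for the corrected step.  The fast part of R is E exactly, and the
slow projector P is idempotent and commutes with E, so R - E = P (S - E) P.
Everything therefore rests on the base step having order four.

That is a finite computation.  Let X = I - h B + h^2/6 B L and
Y = I - h/2 B + h^2/8 B L be the matrices inverted in S and in its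
intermediate stage, and let T2, T4 be the Taylor polynomials of exp (h/2 L) of
degree 2 and of E of degree 4.  Substituting A = L - B, so that only the words
L^j and B L^j occur, one finds that Y T2 is the numerator of the stage up to
h^4/64 B L^3 [stage_denom_mul_taylor], and that X T4 is the numerator of S, with
T2 in place of the stage, up to a multiple of h^5 [step_denom_mul_taylor].
With the exact tail of the exponential series this gives S - E = h^5 W near
h = 0, where W is the explicit function [step_error].

Hence R - E = h^5 (P W P) and R - S = h^5 (P W P - W).  W is built by sums,
products and inverses from polynomials and from an entire power series, so all
its iterated derivatives exist near 0.  In particular W is continuous at 0,
which gives the two O(h^5) bounds; and differentiating h^m G leaves a factor
h^(m-1), so the derivatives of order at most 4 of h^5 G vanish at 0, which gives
the agreement of the Taylor coefficients [derive1n_eq_scale].  This argument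
uses neither the mean value theorem nor Taylor's formula, and so it serves real
and complex h alike.  Only the convergence of the exponential series depends on
the scalars; the property of the field that it needs is [exp_complete], which is
then checked for the real and for the complex numbers. *)

(** * Limits and derivatives of matrix-valued functions *)

Lemma cvg_mxP (K : numFieldType) (m n : nat) (T : Type) (F : set_system T)
    {FF : Filter F} (f : T -> 'M[K]_(m, n)) (M : 'M[K]_(m, n)) :
  f @ F --> M <-> forall i j, f x i j @[x --> F] --> M i j.
Proof.
split=> [fM i j|fM].
  apply: (@cvg_comp _ _ _ f (fun N : 'M[K]_(m, n) => N i j) _ _ _ fM).
  exact: coord_continuous.
apply/cvg_ballP => e e0.
have near_entries : \forall x \near F, forall ij : 'I_m * 'I_n,
    ball (M ij.1 ij.2) e (f x ij.1 ij.2).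
  by apply: filter_forall => -[i j] /=; move/cvg_ballP: (fM i j); exact.
by apply: filterS near_entries => x fx; split=> // i j; exact: (fx (i, j)).
Qed.

Lemma cvg_mulmx (K : numFieldType) (m n p : nat) (T : Type) (F : set_system T)
    {FF : Filter F} (f : T -> 'M[K]_(m, n)) (g : T -> 'M[K]_(n, p))
    (M : 'M[K]_(m, n)) (N : 'M[K]_(n, p)) :
  f @ F --> M -> g @ F --> N -> (fun x => f x *m g x) @ F --> M *m N.
Proof.
move=> /cvg_mxP fM /cvg_mxP gN; apply/cvg_mxP => i j.
rewrite mxE; under eq_fun do rewrite mxE.
apply: cvg_big => [|k _]; first exact: add_continuous.
by apply: cvgM; [exact: fM|exact: gN].
Qed.

Lemma cvg_det (K : numFieldType) (n : nat) (T : Type) (F : set_system T)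
    {FF : Filter F} (f : T -> 'M[K]_n) (M : 'M[K]_n) :
  f @ F --> M -> \det (f x) @[x --> F] --> \det M.
Proof.
move=> /cvg_mxP fM; apply: cvg_big => [|s _]; first exact: add_continuous.
apply: cvgM; first exact: cvg_cst.
by apply: cvg_big => [|i _]; [exact: mul_continuous|exact: fM].
Qed.

Lemma near_unitmx (K : numFieldType) (n : nat) (T : Type) (F : set_system T)
    {FF : Filter F} (f : T -> 'M[K]_n) (M : 'M[K]_n) :
  f @ F --> M -> M \in unitmx -> \forall x \near F, f x \in unitmx.
Proof.
move=> fM; rewrite unitmxE unitfE => detM.
near=> x; rewrite unitmxE unitfE; near: x.
exact: (cvgr_neq0 _ (cvg_det fM)) detM.
Unshelve. all: by end_near. Qed.

(** Near a unit the inverse is the adjugate divided by the determinant,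
both polynomial in the entries. *)
Lemma cvg_invmx (K : numFieldType) (n : nat) (T : Type) (F : set_system T)
    {FF : Filter F} (f : T -> 'M[K]_n) (M : 'M[K]_n) :
  f @ F --> M -> M \in unitmx -> invmx (f x) @[x --> F] --> invmx M.
Proof.
move=> fM unitM; have unitf := near_unitmx fM unitM.
have detM : \det M != 0 by rewrite -unitfE -unitmxE.
rewrite /(invmx M) unitM.
apply: (@cvg_trans _ ((fun x => (\det (f x))^-1 *: \adj (f x)) @ F)).
  apply: near_eq_cvg; near=> x.
  have unitfx : f x \in unitmx by near: x; exact: unitf.
  by rewrite /invmx unitfx.
apply: cvgZ; first by apply: cvgV => //; exact: cvg_det.
apply/cvg_mxP => i j; rewrite mxE; under eq_fun do rewrite mxE.
apply: cvgM; first exact: cvg_cst.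
apply: cvg_det; apply/cvg_mxP => k l; rewrite !mxE.
under eq_fun do rewrite !mxE.
by move/cvg_mxP: fM; exact.
Unshelve. all: by end_near. Qed.

Lemma is_derive1P (K : numFieldType) (V : normedModType K) (f : K -> V) (a : K)
    (d : V) :
  is_derive a 1 f d <->
  (fun t => t^-1 *: (f (t + a) - f a)) @ (0 : K)^' --> d.
Proof.
have E : (fun t : K => t^-1 *: ((f \o shift a) (t *: 1) - f a)) =
         (fun t => t^-1 *: (f (t + a) - f a)).
  by apply/funext => t /=; rewrite [t *: 1]mulr1.
split=> [[df <-]|df].
  by rewrite /derive -E; exact: df.
by split; [rewrite /derivable E; apply/cvg_ex; exists d|
  rewrite /derive E; exact/cvg_lim].
Qed.

(** Continuity along the punctured filter, the one of difference quotients. *)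
Lemma is_derive1_cvg (K : numFieldType) (V : normedModType K) (f : K -> V)
    (a : K) (d : V) :
  is_derive a 1 f d -> f (t + a) @[t --> (0 : K)^'] --> f a.
Proof.
move=> /is_derive1P fd.
have -> : f a = (0 : K) *: d + f a by rewrite scale0r add0r.
apply: (@cvg_trans _ ((fun t : K => t *: (t^-1 *: (f (t + a) - f a)) + f a)
   @ (0 : K)^')).
  apply: near_eq_cvg; near=> t.
  rewrite scalerA mulfV ?scale1r ?subrK//.
  by near: t; exact: nbhs_dnbhs_neq.
apply: cvgD; last exact: cvg_cst.
apply: cvgZ fd; apply: nbhs_dnbhs.
Unshelve. all: by end_near. Qed.

Lemma is_derive_mxP (K : numFieldType) (m n : nat) (f : K -> 'M[K]_(m, n))
    (a : K) (d : 'M[K]_(m, n)) :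
  is_derive a 1 f d <-> forall i j, is_derive a 1 (fun t => f t i j) (d i j).
Proof.
rewrite is_derive1P cvg_mxP; split=> fd i j.
  apply/is_derive1P; move: (fd i j); under eq_fun do rewrite !mxE.
  exact.
under eq_fun do rewrite !mxE.
by move/is_derive1P: (fd i j).
Qed.

(** Leibniz rule in the order of the factors, from
f' g' - f g = (f' - f) g' + f (g' - g). *)
Lemma is_derive_mulmx (K : numFieldType) (m n p : nat) (f : K -> 'M[K]_(m, n))
    (g : K -> 'M[K]_(n, p)) (a : K) df dg :
  is_derive a 1 f df -> is_derive a 1 g dg ->
  is_derive a 1 (fun t => f t *m g t) (df *m g a + f a *m dg).
Proof.
move=> fd gd; have gc := is_derive1_cvg gd.
move/is_derive1P in fd; move/is_derive1P in gd; apply/is_derive1P.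
have E : (fun t => t^-1 *: (f (t + a) *m g (t + a) - f a *m g a)) =
   (fun t => (t^-1 *: (f (t + a) - f a)) *m g (t + a) +
             f a *m (t^-1 *: (g (t + a) - g a))).
  apply/funext => t; rewrite -scalemxAl -scalemxAr -scalerDr mulmxBl mulmxBr.
  by rewrite addrA subrK.
rewrite E; apply: cvgD; apply: cvg_mulmx => //; exact: cvg_cst.
Qed.

(** From N^-1 - M^-1 = - N^-1 (N - M) M^-1 and the continuity of
inversion. *)
Lemma is_derive_invmx (K : numFieldType) (n : nat) (f : K -> 'M[K]_n)
    (a : K) df :
  is_derive a 1 f df -> f a \in unitmx ->
  is_derive a 1 (fun t => invmx (f t)) (- (invmx (f a) *m df *m invmx (f a))).
Proof.
move=> fd unitfa; have fc := is_derive1_cvg fd.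
have unitf := near_unitmx fc unitfa.
move/is_derive1P in fd; apply/is_derive1P.
apply: (@cvg_trans _ ((fun t => - (invmx (f (t + a)) *m
    (t^-1 *: (f (t + a) - f a)) *m invmx (f a))) @ (0 : K)^')).
  apply: near_eq_cvg; near=> t.
  have unitft : f (t + a) \in unitmx by near: t; exact: unitf.
  rewrite -scalemxAr -scalemxAl -scalerN mulmxBr mulVmx// mulmxBl mul1mx.
  by rewrite -mulmxA mulmxV// mulmx1 opprB.
apply: cvgN; apply: cvg_mulmx; last exact: cvg_cst.
by apply: cvg_mulmx => //; exact: cvg_invmx.
Unshelve. all: by end_near. Qed.

(** * Iterated differentiability near 0 *)

(** Peels the derivatives off from the inside, which is the form that the
inductions below follow. *)
Lemma has_taylor_coefsS (K : numFieldType) (V : normedModType K)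
    (f : K -> V) N :
  has_taylor_coefs f N.+1 <->
  (\forall h \near (0 : K), derivable f h 1) /\ has_taylor_coefs (derive1 f) N.
Proof.
split=> [fN|[f0 fN] [|k] kN //].
  split=> [|k kN]; first exact: (fN 0).
  by rewrite -derive1Sn; exact: fN.
by rewrite derive1Sn; exact: fN.
Qed.

(** Iterated derivatives at points near 0 only see the germ of the function
at 0, since an equality near 0 holds near each point near 0. *)
Lemma near_eq_has_taylor_coefs (K : numFieldType) (V : normedModType K)
    (f g : K -> V) N :
  (\forall h \near (0 : K), f h = g h) ->
  has_taylor_coefs f N -> has_taylor_coefs g N.
Proof.
elim: N f g => [//|N IH] f g fg /has_taylor_coefsS[fd fN].
have fgg := near_join fg.
apply/has_taylor_coefsS; split.
  near=> h; apply: (@near_eq_derivable _ _ _ f); first by near: h; exact: fgg.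
  by near: h; exact: fd.
apply: IH fN; near=> h; rewrite !derive1E; apply: near_eq_derive.
by near: h; exact: fgg.
Unshelve. all: by end_near. Qed.

Lemma has_taylor_coefs_is_derive (K : numFieldType) (V : normedModType K)
    (f g : K -> V) N :
  (\forall h \near (0 : K), is_derive (h : K) 1 f (g h)) ->
  has_taylor_coefs g N -> has_taylor_coefs f N.+1.
Proof.
move=> fg gN; apply/has_taylor_coefsS; split.
  by apply: filterS fg => h [].
apply: near_eq_has_taylor_coefs gN.
by apply: filterS fg => h [_ <-]; rewrite derive1E.
Qed.

Lemma has_taylor_coefs_near_derive (K : numFieldType) (V : normedModType K)
    (f : K -> V) N :
  has_taylor_coefs f N.+1 ->
  \forall h \near (0 : K), is_derive (h : K) 1 f (derive1 f h).
Proof.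
move=> /has_taylor_coefsS[fd _]; apply: filterS fd => h fd.
by split => //; rewrite derive1E.
Qed.

Lemma has_taylor_coefsW (K : numFieldType) (V : normedModType K) (f : K -> V)
    (M N : nat) :
  (M <= N)%N -> has_taylor_coefs f N -> has_taylor_coefs f M.
Proof. by move=> MN fN k kM; apply: fN; exact: leq_trans MN. Qed.

Lemma has_taylor_coefs_cst (K : numFieldType) (V : normedModType K) (v : V) N :
  has_taylor_coefs (fun _ : K => v) N.
Proof.
elim: N v => [//|N IH] v; apply: has_taylor_coefs_is_derive (IH 0).
by apply: filterE => h; exact: is_derive_cst.
Qed.

Lemma has_taylor_coefs_id (K : numFieldType) N :
  has_taylor_coefs (fun h : K => h) N.
Proof.
case: N => // N; apply: (@has_taylor_coefs_is_derive K K _ (fun=> 1)).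
  by apply: filterE => h; exact: is_derive_id.
exact: has_taylor_coefs_cst.
Qed.

Lemma has_taylor_coefsD (K : numFieldType) (V : normedModType K)
    (f g : K -> V) N :
  has_taylor_coefs f N -> has_taylor_coefs g N ->
  has_taylor_coefs (fun h => f h + g h) N.
Proof.
elim: N f g => [//|N IH] f g fN gN.
have fd := has_taylor_coefs_near_derive fN.
have gd := has_taylor_coefs_near_derive gN.
move/has_taylor_coefsS: fN => [_ /IH fN]; move/has_taylor_coefsS: gN => [_ /fN].
apply: has_taylor_coefs_is_derive; near=> h; apply: is_deriveD.
  by near: h; exact: fd.
by near: h; exact: gd.
Unshelve. all: by end_near. Qed.

Lemma is_derive_scale (K : numFieldType) (V : normedModType K) (s : K -> K)
    (f : K -> V) (a ds : K) (df : V) :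
  is_derive a 1 s ds -> is_derive a 1 f df ->
  is_derive a 1 (fun t => s t *: f t) (ds *: f a + s a *: df).
Proof.
move=> sd fd; have fc := is_derive1_cvg fd.
move/is_derive1P in sd; move/is_derive1P in fd; apply/is_derive1P.
have E : (fun t => t^-1 *: (s (t + a) *: f (t + a) - s a *: f a)) =
   (fun t => (t^-1 * (s (t + a) - s a)) *: f (t + a) +
             s a *: (t^-1 *: (f (t + a) - f a))).
  apply/funext => t; rewrite [s a *: (_ *: _)]scalerA [s a * _]mulrC -!scalerA.
  by rewrite -scalerDr scalerBl [s a *: (_ - _)]scalerBr addrA subrK.
by rewrite E; apply: cvgD; apply: cvgZ => //; exact: cvg_cst.
Qed.

Lemma has_taylor_coefs_scale (K : numFieldType) (V : normedModType K)
    (s : K -> K) (f : K -> V) N :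
  has_taylor_coefs s N -> has_taylor_coefs f N ->
  has_taylor_coefs (fun h => s h *: f h) N.
Proof.
elim: N s f => [//|N IH] s f sN fN.
have sd := has_taylor_coefs_near_derive sN.
have fd := has_taylor_coefs_near_derive fN.
move/has_taylor_coefsS: (sN) => [_ s'N].
move/has_taylor_coefsS: (fN) => [_ f'N].
have sN' := has_taylor_coefsW (leqnSn N) sN.
have fN' := has_taylor_coefsW (leqnSn N) fN.
apply: has_taylor_coefs_is_derive
  (has_taylor_coefsD (IH _ _ s'N fN') (IH _ _ sN' f'N)).
near=> h; apply: is_derive_scale.
  by near: h; exact: sd.
by near: h; exact: fd.
Unshelve. all: by end_near. Qed.

Lemma has_taylor_coefsZ (K : numFieldType) (V : normedModType K) (c : K)
    (f : K -> V) N :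
  has_taylor_coefs f N -> has_taylor_coefs (fun h => c *: f h) N.
Proof. by apply: has_taylor_coefs_scale; exact: has_taylor_coefs_cst. Qed.

Lemma has_taylor_coefsX (K : numFieldType) (m N : nat) :
  has_taylor_coefs (fun h : K => h ^+ m) N.
Proof.
elim: m => [|m IH]; first exact: (@has_taylor_coefs_cst K K 1 N).
have := @has_taylor_coefs_scale K K _ _ N (@has_taylor_coefs_id K N) IH.
by congr has_taylor_coefs; apply/funext => h; rewrite exprS.
Qed.

Lemma has_taylor_coefs_scaleX (K : numFieldType) (V : normedModType K)
    (m : nat) (a : K) (f : K -> V) (N : nat) :
  has_taylor_coefs f N -> has_taylor_coefs (fun h => (h ^+ m / a) *: f h) N.
Proof.
move=> fN; have aN := @has_taylor_coefs_cst K K a^-1 N.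
exact: (has_taylor_coefs_scale
  (@has_taylor_coefs_scale K K _ _ N (@has_taylor_coefsX K m N) aN) fN).
Qed.

Lemma has_taylor_coefsB (K : numFieldType) (V : normedModType K)
    (f g : K -> V) N :
  has_taylor_coefs f N -> has_taylor_coefs g N ->
  has_taylor_coefs (fun h => f h - g h) N.
Proof.
move=> fN /(has_taylor_coefsZ (-1)) gN.
have -> : (fun h => f h - g h) = (fun h => f h + -1 *: g h).
  by apply/funext => h; rewrite scaleN1r.
exact: has_taylor_coefsD.
Qed.

Lemma has_taylor_coefs_mulmx (K : numFieldType) (m n p : nat)
    (f : K -> 'M[K]_(m, n)) (g : K -> 'M[K]_(n, p)) N :
  has_taylor_coefs f N -> has_taylor_coefs g N ->
  has_taylor_coefs (fun h => f h *m g h) N.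
Proof.
elim: N f g => [//|N IH] f g fN gN.
have fd := has_taylor_coefs_near_derive fN.
have gd := has_taylor_coefs_near_derive gN.
move/has_taylor_coefsS: (fN) => [_ f'N].
move/has_taylor_coefsS: (gN) => [_ g'N].
have fN' := has_taylor_coefsW (leqnSn N) fN.
have gN' := has_taylor_coefsW (leqnSn N) gN.
apply: has_taylor_coefs_is_derive
  (has_taylor_coefsD (IH _ _ f'N gN') (IH _ _ fN' g'N)).
near=> h; apply: is_derive_mulmx.
  by near: h; exact: fd.
by near: h; exact: gd.
Unshelve. all: by end_near. Qed.

Lemma has_taylor_coefs_continuous (K : numFieldType) (V : normedModType K)
    (f : K -> V) :
  has_taylor_coefs f 1 -> f @ (0 : K) --> f 0.
Proof.
move=> /has_taylor_coefsS[/nbhs_singleton /derivable1_diffP f0 _].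
exact: (differentiable_continuous f0).
Qed.

(** The derivative - f^-1 f' f^-1 involves the inverse itself, at one order of
differentiability less, so induction on the order closes the argument. *)
Lemma has_taylor_coefs_invmx (K : numFieldType) (n : nat)
    (f : K -> 'M[K]_n) N :
  f 0 \in unitmx -> has_taylor_coefs f N ->
  has_taylor_coefs (fun h => invmx (f h)) N.
Proof.
elim: N => [|N IH] f0 fN; first by move=> k; rewrite ltn0.
have fd := has_taylor_coefs_near_derive fN.
have f0c := has_taylor_coefs_continuous (has_taylor_coefsW (ltn0Sn N) fN).
have unitf := near_unitmx f0c f0.
move/has_taylor_coefsS: (fN) => [_ f'N].
have gN := IH f0 (has_taylor_coefsW (leqnSn N) fN).
apply: (@has_taylor_coefs_is_derive _ _ _
  (fun h => -1 *: (invmx (f h) *m derive1 f h *m invmx (f h)))).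
  near=> h; rewrite scaleN1r; apply: is_derive_invmx.
    by near: h; exact: fd.
  by near: h; exact: unitf.
apply: has_taylor_coefsZ.
exact: (has_taylor_coefs_mulmx (has_taylor_coefs_mulmx gN f'N) gN).
Unshelve. all: by end_near. Qed.

Lemma has_taylor_coefs_mx (K : numFieldType) (m n : nat)
    (f : K -> 'M[K]_(m, n)) N :
  (forall i j, has_taylor_coefs (fun h => f h i j) N) -> has_taylor_coefs f N.
Proof.
elim: N f => [//|N IH] f fN.
apply: (@has_taylor_coefs_is_derive _ _ _
  (fun h => \matrix_(i, j) derive1 (fun t => f t i j) h)).
  pose d (ij : 'I_m * 'I_n) (h : K) := is_derive (h : K) 1
    (fun t => f t ij.1 ij.2) (derive1 (fun t => f t ij.1 ij.2) h).
  have fd : \forall h \near (0 : K), forall ij, d ij h.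
    apply: (filter_forall (F := nbhs (0 : K)) _) => ij.
    exact: (has_taylor_coefs_near_derive (fN ij.1 ij.2)).
  apply: filterS fd => h fd; apply/is_derive_mxP => i j; rewrite mxE.
  exact: (fd (i, j)).
apply: IH => i j; have /has_taylor_coefsS[_] := fN i j.
by congr has_taylor_coefs; apply/funext => h; rewrite mxE.
Qed.

(** * Functions equal up to a power of h *)

(** The derivative of h^(m+1) W is h^m ((m+1) W + h W'), of the same shape
with one power of h less; k < m derivatives leave a factor h. *)
Lemma derive1n_eq_scale (K : numFieldType) (V : normedModType K)
    (f g W : K -> V) (k m N : nat) :
  (k <= N)%N -> (k < m)%N ->
  has_taylor_coefs f N -> has_taylor_coefs g N -> has_taylor_coefs W N ->
  (\forall h \near (0 : K), f h - g h = h ^+ m *: W h) ->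
  derive1n k f 0 = derive1n k g 0.
Proof.
elim: k m N f g W => [|k IH] [//|m] N f g W kN km fN gN WN fgW.
  apply/eqP; rewrite -subr_eq0; move/nbhs_singleton: fgW => ->.
  by rewrite expr0n scale0r.
case: N kN fN gN WN => // N kN fN gN WN; rewrite !derive1Sn.
have fd := has_taylor_coefs_near_derive fN.
have gd := has_taylor_coefs_near_derive gN.
have Wd := has_taylor_coefs_near_derive WN.
have WN' := has_taylor_coefsW (leqnSn N) WN.
have [_ f'N] := (has_taylor_coefsS f N).1 fN.
have [_ g'N] := (has_taylor_coefsS g N).1 gN.
have [_ W'N] := (has_taylor_coefsS W N).1 WN.
apply: (IH m N (derive1 f) (derive1 g)
  (fun h => m.+1%:R *: W h + h *: derive1 W h)) => //.
  apply: has_taylor_coefsD; first exact: has_taylor_coefsZ.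
  by apply: has_taylor_coefs_scale => //; exact: has_taylor_coefs_id.
have fgW' := near_join fgW.
near=> h.
have fdh : is_derive (h : K) 1 f (derive1 f h) by near: h; exact: fd.
have gdh : is_derive (h : K) 1 g (derive1 g h) by near: h; exact: gd.
have Wdh : is_derive (h : K) 1 W (derive1 W h) by near: h; exact: Wd.
have [_ <-] := is_deriveB fdh gdh.
rewrite (@near_eq_derive _ _ _ (f - g) (fun h => h ^+ m.+1 *: W h));
  last by near: h; exact: fgW'.
have Xd : is_derive (h : K) 1 (fun t : K => t ^+ m.+1) (m.+1%:R * h ^+ m).
  split; first exact: exprn_derivable.
  by rewrite exp_derive /= [_ *: 1]mulr1.
have [_ ->] := is_derive_scale Xd Wdh.
by rewrite scalerDr !scalerA -exprSr [h ^+ m * _]mulrC.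
Unshelve. all: by end_near. Qed.

Lemma taylor_agree_scale (K : numFieldType) (V : normedModType K)
    (f g W : K -> V) (m N : nat) :
  (N < m)%N ->
  has_taylor_coefs f N -> has_taylor_coefs g N -> has_taylor_coefs W N ->
  (\forall h \near (0 : K), f h - g h = h ^+ m *: W h) ->
  taylor_agree f g N.
Proof.
move=> Nm fN gN WN fgW; split=> // k kN; congr (_ *: _).
exact: (derive1n_eq_scale kN (leq_ltn_trans kN Nm) fN gN WN fgW).
Qed.

Lemma eqO_scale (K : numFieldType) (V : normedModType K) (f W : K -> V)
    (m : nat) :
  W @ (0 : K) --> W 0 ->
  (\forall h \near (0 : K), f h = h ^+ m *: W h) ->
  f =O_ (0 : K) (fun h : K => h ^+ m).
Proof.
move=> /cvgrPdist_le/(_ 1 ltr01) W0 fW; apply/eqO_exP.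
exists (`|W 0| + 1); first by rewrite ltr_wpDl.
near=> h.
have -> : f h = h ^+ m *: W h by near: h; exact: fW.
rewrite normrZ mulrC ler_wpM2r//.
have W0h : `|W 0 - W h| <= 1 by near: h; exact: W0.
by rewrite -[W h](subKr (W 0)) (le_trans (ler_normB _ _))// lerD2l.
Unshelve. all: by end_near. Qed.

(** * Power series with exponentially dominated coefficients *)

(** What the exponential series requires of the scalars: the partial sums of
the exponential series of a nonnegative element are bounded, and absolutely
summable series converge.  The first condition is not automatic, since a
numeric field need not be Archimedean. *)
Definition exp_complete (K : numFieldType) : Prop :=
  (forall x : K, 0 <= x ->
     exists M, forall N, series (fun k => x ^+ k / k`!%:R) N <= M) /\
  (forall u : nat -> K,
     (exists M, forall N, series (fun k => `|u k|) N <= M) -> cvgn (series u)).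

(** Coefficients bounded by those of C exp (q h).  The factor C makes the class
stable under shift and formal derivation, which multiply the bound by q. *)
Definition exp_dominated (K : numFieldType) (a : nat -> K) : Prop :=
  exists2 Cq : K * K, 0 <= Cq.1 /\ 0 <= Cq.2 &
    forall k, `|a k| <= Cq.1 * (Cq.2 ^+ k / k`!%:R).

Definition psum (K : numFieldType) (a : nat -> K) (h : K) : K :=
  limn (series (fun k => a k * h ^+ k)).

Lemma exp_dominated_shift (K : numFieldType) (a : nat -> K) :
  exp_dominated a -> exp_dominated (fun k => a k.+1).
Proof.
move=> [[C q] /= [C0 q0] aC]; exists (C * q, q) => /=.
  by split=> //; exact: mulr_ge0.
move=> k; apply: le_trans (aC k.+1) _.
rewrite -mulrA ler_wpM2l// exprS -mulrA ler_wpM2l// ler_wpM2l ?exprn_ge0//.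
by rewrite lef_pV2 ?posrE ?ltr0n ?fact_gt0// ler_nat factS leq_pmull.
Qed.

Lemma exp_dominated_shiftn (K : numFieldType) (a : nat -> K) (m : nat) :
  exp_dominated a -> exp_dominated (fun k => a (k + m)%N).
Proof.
elim: m a => [|m IH] a aE.
  by rewrite (_ : (fun k => _) = a)//; apply/funext => k; rewrite addn0.
have := exp_dominated_shift (IH _ aE).
by congr exp_dominated; apply/funext => k; rewrite addSnnS.
Qed.

Lemma exp_dominated_deriv (K : numFieldType) (a : nat -> K) :
  exp_dominated a -> exp_dominated (fun k => k.+1%:R * a k.+1).
Proof.
move=> [[C q] /= [C0 q0] aC]; exists (C * q, q) => /=.
  by split=> //; exact: mulr_ge0.
move=> k; rewrite normrM normr_nat.
apply: le_trans (ler_wpM2l (ler0n _ _) (aC k.+1)) _.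
rewrite le_eqVlt; apply/orP; left; apply/eqP.
rewrite factS natrM exprS; field.
by rewrite addrC natr1 !pnatr_eq0 /= -lt0n fact_gt0.
Qed.

Lemma exp_dominated_bounded (K : numFieldType) (a : nat -> K) (r : K) :
  exp_complete K -> exp_dominated a -> 0 <= r ->
  exists2 M, 0 <= M & forall N, series (fun k => `|a k| * r ^+ k) N <= M.
Proof.
move=> [Kexp _] [[C q] /= [C0 q0] aC] r0.
have [M MN] := Kexp (q * r) (mulr_ge0 q0 r0).
exists (C * M).
  by rewrite mulr_ge0//; have := MN 0%N; rewrite /series /= big_geq.
move=> N; apply: le_trans (ler_wpM2l C0 (MN N)).
rewrite /series /= mulr_sumr ler_sum// => k _.
by rewrite exprMn [X in _ <= C * X]mulrAC mulrA ler_wpM2r ?exprn_ge0.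
Qed.

Lemma is_cvg_psum (K : numFieldType) (a : nat -> K) (h : K) :
  exp_complete K -> exp_dominated a -> cvgn (series (fun k => a k * h ^+ k)).
Proof.
move=> KE aE; have [M _ MN] := exp_dominated_bounded KE aE (normr_ge0 h).
apply: KE.2; exists M => N; apply: le_trans (MN N).
by apply: ler_sum => k _; rewrite normrM normrX.
Qed.

Lemma cvg_psum (K : numFieldType) (a : nat -> K) (h : K) :
  exp_complete K -> exp_dominated a ->
  series (fun k => a k * h ^+ k) @ \oo --> psum a h.
Proof. exact: is_cvg_psum. Qed.

Lemma psum_shift (K : numFieldType) (a : nat -> K) (h : K) :
  exp_complete K -> exp_dominated a ->
  psum a h = a 0%N + h * psum (fun k => a k.+1) h.
Proof.
move=> KE aE; apply/cvg_lim => //; rewrite -cvg_shiftS /=.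
have -> : (fun n => series (fun k => a k * h ^+ k) n.+1) =
    (fun n => a 0%N + h * series (fun k => a k.+1 * h ^+ k) n).
  apply/funext => n; rewrite /series /= big_nat_recl// expr0 mulr1 mulr_sumr.
  by congr (_ + _); apply: eq_bigr => k _; rewrite exprS mulrCA.
apply: cvgD; first exact: cvg_cst.
apply: cvgM; first exact: cvg_cst.
by apply: cvg_psum => //; exact: exp_dominated_shift.
Qed.

Lemma psum_split (K : numFieldType) (a : nat -> K) (h : K) (m : nat) :
  exp_complete K -> exp_dominated a ->
  psum a h = \sum_(k < m) a k * h ^+ k + h ^+ m * psum (fun k => a (k + m)%N) h.
Proof.
move=> KE aE; elim: m => [|m IH].
  rewrite big_ord0 add0r expr0 mul1r; congr (psum _ h).
  by apply/funext => k; rewrite addn0.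
rewrite IH psum_shift//; last exact: exp_dominated_shiftn.
rewrite big_ord_recr /= add0n mulrDr addrA [h ^+ m * a m]mulrC mulrA -exprSr.
by congr (_ + _ * psum _ h); apply/funext => k; rewrite addSnnS.
Qed.

Lemma norm_lim_le (K : numFieldType) (u : nat -> K) (l c : K) :
  u @ \oo --> l -> (forall N, `|u N| <= c) -> `|l| <= c.
Proof.
move=> ul uc; have c0 : 0 <= c := le_trans (normr_ge0 _) (uc 0%N).
have [//|cl] := real_leP (normr_real l) (ger0_real c0).
have e0 : 0 < `|l| - c by rewrite subr_gt0.
move/cvgrPdist_lt: ul => /(_ _ e0)[N _ /(_ N (leqnn N)) uN].
have := le_lt_trans (ler_normD (l - u N) (u N)) (ltr_leD uN (uc N)).
by rewrite !subrK ltxx.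
Qed.

(** Second-order remainder of the monomial h^k.  The factor 2^k, instead of
k (k - 1) / 2, keeps the induction short and is harmless because k! absorbs it
after summation. *)
Lemma expr_taylor1 (K : numFieldType) (h t : K) (k : nat) :
  `|t| <= 1 ->
  `|(t + h) ^+ k - h ^+ k - t * (k%:R * h ^+ k.-1)|
    <= `|t| ^+ 2 * (2 * (`|h| + 1)) ^+ k.
Proof.
move=> t1; set r := `|h| + 1.
have r1 : 1 <= r by rewrite /r lerDr.
have r0 : 0 <= r := le_trans ler01 r1.
have th : `|t + h| <= r by rewrite /r (le_trans (ler_normD _ _))// addrC lerD2l.
have hr : `|h| <= r by rewrite /r lerDl.
have t2 : 0 <= `|t| ^+ 2 by rewrite exprn_ge0.
elim: k => [|k IH].
  by rewrite !expr0 mul0r mulr0 subrr subr0 normr0 mulr1.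
case: k IH => [|k] IH.
  rewrite !expr1 expr0 !mulr1 addrK subrr normr0 mulr_ge0//.
  by rewrite mulr_ge0.
(* The remainder D_k satisfies D_(k+1) = (t + h) D_k + k t^2 h^(k-1). *)
have -> : (t + h) ^+ k.+2 - h ^+ k.+2 - t * (k.+2%:R * h ^+ k.+2.-1) =
  (t + h) * ((t + h) ^+ k.+1 - h ^+ k.+1 - t * (k.+1%:R * h ^+ k.+1.-1))
  + t ^+ 2 * (k.+1%:R * h ^+ k).
  by rewrite /= !exprS -[k.+2]addn1 natrD; ring.
apply: le_trans (ler_normD _ _) _; rewrite !normrM normr_nat !normrX.
apply: le_trans (lerD (ler_pM (normr_ge0 _) (normr_ge0 _) th IH) (lexx _)) _.
rewrite mulrCA -mulrDr ler_wpM2l//.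
have -> : (2 * r) ^+ k.+2 = r * (2 * r) ^+ k.+1 + r * (2 * r) ^+ k.+1.
  by rewrite exprS; ring.
rewrite lerD2l.
apply: (@le_trans _ _ (2 ^+ k.+1 * r ^+ k.+1)); last first.
  rewrite exprMn mulrCA ler_wpM2l ?exprn_ge0//.
  by rewrite ler_peMl// exprn_ge0.
apply: ler_pM => //.
- by rewrite -natrX ler_nat ltnW// ltn_expl.
apply: (@le_trans _ _ (r ^+ k)); first by rewrite lerXn2r ?nnegrE.
by rewrite exprS ler_peMl// exprn_ge0.
Qed.

(** Term-by-term differentiation: summing [expr_taylor1] against the
coefficients bounds the remainder of the series by M |t|^2 for |t| <= 1. *)
Lemma is_derive_psum (K : numFieldType) (a : nat -> K) (h : K) :
  exp_complete K -> exp_dominated a ->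
  is_derive h 1 (psum a) (psum (fun k => k.+1%:R * a k.+1) h).
Proof.
move=> KE aE; set d := psum _ h.
have r0 : 0 <= 2 * (`|h| + 1) :> K by rewrite mulr_ge0// addr_ge0.
have [M M0 MN] := exp_dominated_bounded KE aE r0.
have rem (t : K) : `|t| <= 1 ->
    `|psum a (t + h) - psum a h - t * d| <= `|t| ^+ 2 * M.
  move=> t1.
  pose w := series (fun k => a k *
    ((t + h) ^+ k - h ^+ k - t * (k%:R * h ^+ k.-1))).
  apply: (@norm_lim_le _ w).
    have -> : w = (fun N => series (fun k => a k * (t + h) ^+ k) N
        - series (fun k => a k * h ^+ k) N
        - t * series (fun k => k%:R * a k * h ^+ k.-1) N).
      apply/funext => N; rewrite /w /series /= mulr_sumr -!sumrB.
      by apply: eq_bigr => k _; ring.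
    apply: cvgB; first by apply: cvgB; exact: cvg_psum.
    apply: cvgM; first exact: cvg_cst.
    (* The constant term has derivative 0, so the derived series starts at 1. *)
    rewrite -cvg_shiftS /=.
    have -> : (fun n => series (fun k => k%:R * a k * h ^+ k.-1) n.+1) =
        series (fun k => k.+1%:R * a k.+1 * h ^+ k).
      by apply/funext => n; rewrite /series /= big_nat_recl// !mul0r add0r.
    by apply: cvg_psum => //; exact: exp_dominated_deriv.
  move=> N; apply: le_trans (ler_norm_sum _ _ _) _.
  apply: le_trans (ler_wpM2l (exprn_ge0 2 (normr_ge0 t)) (MN N)).
  rewrite mulr_sumr ler_sum// => k _; rewrite normrM [leRHS]mulrCA ler_wpM2l//.
  exact: expr_taylor1.
apply/is_derive1P/cvgrPdist_le => e e0.
near=> t.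
have t0 : t != 0 by near: t; exact: nbhs_dnbhs_neq.
have t1 : `|t| <= 1 by near: t; exact: dnbhs0_le.
have te : `|t| <= e / (M + 1).
  by near: t; apply: dnbhs0_le; rewrite divr_gt0// ltr_wpDl.
have -> : d - t^-1 *: (psum a (t + h) - psum a h) =
    - (t^-1 * (psum a (t + h) - psum a h - t * d)).
  by rewrite mulrBr mulKf// opprB.
rewrite normrN normrM normfV ler_pdivrMl ?normr_gt0//.
apply: le_trans (rem t t1) _; rewrite expr2 -mulrA ler_wpM2l//.
rewrite -[leRHS](@divfK _ (M + 1)) ?gt_eqF ?ltr_wpDl//.
by apply: ler_pM => //; rewrite lerDl.
Unshelve. all: by end_near. Qed.

Lemma has_taylor_coefs_psum (K : numFieldType) (a : nat -> K) (N : nat) :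
  exp_complete K -> exp_dominated a -> has_taylor_coefs (psum a) N.
Proof.
move=> KE; elim: N a => [//|N IH] a aE.
apply: has_taylor_coefs_is_derive (IH _ (exp_dominated_deriv aE)).
by apply: filterE => h; exact: is_derive_psum.
Qed.

(** * The matrix exponential and its tails *)

(** What remains of the series of exp (h L) after its first m terms, divided by
h^m. *)
Definition exp_tail (K : numFieldType) (n : nat) (L : 'M[K]_n) (m : nat) (h : K)
  : 'M[K]_n :=
  \matrix_(i, j) psum (fun k => (L ^+ (k + m)) i j / (k + m)`!%:R) h.

(** The max norm is not submultiplicative; the sum q of the norms of all
entries bounds the entries of L^k by q^k. *)
Lemma exp_dominated_mx (K : numFieldType) (n : nat) (L : 'M[K]_n) i j :
  exp_dominated (fun k => (L ^+ k) i j / k`!%:R).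
Proof.
pose q := \sum_(ij : 'I_n * 'I_n) `|L ij.1 ij.2|.
have q0 : 0 <= q by exact: sumr_ge0.
exists (1, q) => //= k; rewrite mul1r normrM normfV normr_nat ler_wpM2r//.
elim: k i => [|k IH] i.
  by rewrite !expr0 mxE; case: (i == j); rewrite ?normr1 ?normr0.
rewrite !exprS mxE; apply: le_trans (ler_norm_sum _ _ _) _.
apply: (@le_trans _ _ (\sum_l `|L i l| * q ^+ k)).
  by apply: ler_sum => l _; rewrite normrM ler_wpM2l.
rewrite -mulr_suml ler_wpM2r ?exprn_ge0//.
rewrite /q -(pair_bigA _ (fun i j => `|L i j|)) /= [leRHS](bigD1 i)//= lerDl.
by apply: sumr_ge0 => l _; apply: sumr_ge0.
Qed.

Lemma exprmxZ (K : numFieldType) (n : nat) (L : 'M[K]_n) (h : K) (k : nat) :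
  (h *: L) ^+ k = h ^+ k *: L ^+ k.
Proof.
elim: k => [|k IH]; first by rewrite !expr0 scale1r.
by rewrite !exprS IH -!mulmxE -scalemxAl -scalemxAr scalerA.
Qed.

Lemma cvg_expmx (K : numFieldType) (n : nat) (L : 'M[K]_n) (h : K) :
  exp_complete K ->
  series (fun k => (k`!%:R)^-1 *: (h *: L) ^+ k) @ \oo -->
  \matrix_(i, j) psum (fun k => (L ^+ k) i j / k`!%:R) h.
Proof.
move=> KE; apply/cvg_mxP => i j; rewrite mxE.
have -> : (fun x => series (fun k => (k`!%:R)^-1 *: (h *: L) ^+ k) x i j) =
    series (fun k => (L ^+ k) i j / k`!%:R * h ^+ k).
  apply/funext => N; rewrite /series /= summxE; apply: eq_bigr => k _.
  by rewrite exprmxZ !mxE; ring.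
by apply: cvg_psum => //; exact: exp_dominated_mx.
Qed.

Lemma expmx_split (K : numFieldType) (n : nat) (L : 'M[K]_n) (m : nat) (h : K) :
  exp_complete K ->
  expmx (h *: L) = \sum_(k < m) (h ^+ k / k`!%:R) *: L ^+ k
                   + h ^+ m *: exp_tail L m h.
Proof.
move=> KE; rewrite /expmx (cvg_lim _ (@cvg_expmx K n L h KE))//.
apply/matrixP => i j; rewrite !mxE summxE.
rewrite (@psum_split K _ h m KE)//; last first.
  exact: exp_dominated_mx.
by congr (_ + _); apply: eq_bigr => k _; rewrite mxE; ring.
Qed.

Lemma has_taylor_coefs_exp_tail (K : numFieldType) (n : nat) (L : 'M[K]_n)
    (m N : nat) :
  exp_complete K -> has_taylor_coefs (exp_tail L m) N.
Proof.
move=> KE; apply: has_taylor_coefs_mx => i j.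
have := @has_taylor_coefs_psum K _ N KE
  (exp_dominated_shiftn m (exp_dominated_mx L i j)).
by congr has_taylor_coefs; apply/funext => h; rewrite mxE.
Qed.

(** P commutes with every partial sum of the series. *)
Lemma comm_mx_expmx (K : numFieldType) (n : nat) (P L : 'M[K]_n) (h : K) :
  exp_complete K -> comm_mx P L -> comm_mx P (expmx (h *: L)).
Proof.
move=> KE PL.
have cE := @cvg_expmx K n L h KE.
rewrite /comm_mx /expmx (cvg_lim _ cE)//.
set E := \matrix_(i, j) _ in cE *.
pose u := series (fun k => (k`!%:R)^-1 *: (h *: L) ^+ k).
have l : P *m u N @[N --> \oo] --> P *m E.
  by apply: cvg_mulmx => //; exact: cvg_cst.
suff Pu : (fun N => P *m u N) = (fun N => u N *m P).
  rewrite -(cvg_lim _ l)// Pu; apply/cvg_lim => //.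
  by apply: cvg_mulmx => //; exact: cvg_cst.
apply/funext => N; rewrite /u /series /= mulmx_suml mulmx_sumr.
apply: eq_bigr => k _; rewrite -scalemxAl -scalemxAr; congr (_ *: _).
rewrite exprmxZ -scalemxAl -scalemxAr; congr (_ *: _).
exact: (commrX k PL).
Qed.

(** * The real and the complex numbers *)

Local Open Scope complex_scope.

Lemma exp_complete_real (R : realType) : exp_complete R.
Proof.
split=> [x x0|u [M uM]].
  exists (limn (series (exp_coeff x))) => N.
  apply: nondecreasing_cvgn_le; last exact: is_cvg_series_exp_coeff.
  by apply: nondecreasing_series => k _ _; exact: exp_coeff_ge0.
apply: (@normed_cvg R R); apply: nondecreasing_is_cvgn.
  by apply: nondecreasing_series => k _ _; exact: normr_ge0.
by exists M => _ [N _ <-]; exact: uM.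
Qed.

Lemma norm_real_complex (R : rcfType) (x : R) : `|x%:C| = `|x|%:C.
Proof. by rewrite normc_def /= expr0n addr0 sqrtr_sqr. Qed.

Lemma norm_complex_Im (R : rcfType) (z : R[i]) : `|complex.Im z|%:C <= `|z|.
Proof.
have := normc_ge_Re (z * 'i); rewrite ReiNIm normrN normrM.
by rewrite [`|'i|]normc_def /= expr0n expr1n add0r sqrtr1 mulr1.
Qed.

Lemma cvg_real_complex (R : realType) (C := R[i] : numFieldType) (u : nat -> R)
    (a : R) :
  u @ \oo --> a -> (fun N => (u N)%:C : C) @ \oo --> (a%:C : C).
Proof.
move=> /cvgrPdist_lt ua; apply/cvgrPdist_lt => e e0.
have er : (complex.Re e)%:C = e by rewrite RRe_real// gtr0_real.
have {}e0 : 0 < complex.Re e by rewrite -ltcR er.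
apply: filterS (ua _ e0) => N.
by rewrite -rmorphB norm_real_complex -er ltcR.
Qed.

(** Both conditions reduce to the reals: nonnegative complex numbers are real,
and the real and imaginary parts of an absolutely summable series are absolutely
summable. *)
Lemma exp_complete_complex (R : realType) : exp_complete R[i].
Proof.
have [expR cplR] := exp_complete_real R.
split=> [x x0|u [M uM]].
  have xr : (complex.Re x)%:C = x by rewrite RRe_real// ger0_real.
  have /expR[M MN] : 0 <= complex.Re x by rewrite -ler0c xr.
  exists M%:C => N; rewrite -xr /series /=.
  under eq_bigr do
    rewrite -rmorphXn -(rmorph_nat (real_complex R)) -fmorphV -rmorphM.
  by rewrite -rmorph_sum /= lecR; exact: MN.
have M0 : 0 <= M by apply: le_trans (uM 0%N); rewrite /series /= big_geq.
have Mr : (complex.Re M)%:C = M by rewrite RRe_real// ger0_real.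
have part (p : R[i] -> R) : (forall z, `|p z|%:C <= `|z|) ->
    cvgn (series (fun k => p (u k))).
  move=> pz; apply: cplR; exists (complex.Re M) => N; rewrite -lecR Mr.
  apply: le_trans (uM N); rewrite /series /= rmorph_sum.
  by apply: ler_sum => k _; exact: pz.
have /cvg_real_complex cRe := part _ (@normc_ge_Re R).
have /cvg_real_complex cIm := part _ (@norm_complex_Im R).
have -> : series u = (fun N => (series (fun k => complex.Re (u k)) N)%:C
    + 'i * (series (fun k => complex.Im (u k)) N)%:C).
  apply/funext => N; rewrite /series /= !rmorph_sum mulr_sumr -big_split /=.
  by apply: eq_bigr => k _; exact: complexE.
apply/cvg_ex; eexists; apply: cvgD; first exact: cRe.
by apply: cvgM; [exact: cvg_cst|exact: cIm].
Qed.

Lemma exp_complete_scalar_field (R : realType) (kind : scalar_kind) :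
  exp_complete (scalar_field R kind).
Proof.
by case: kind; [exact: exp_complete_real|exact: exp_complete_complex].
Qed.

Local Close Scope complex_scope.

(** * The base step against the exponential *)

Definition stage_denom (K : numFieldType) (n : nat) (A B : 'M[K]_n) (h : K) :=
  1%:M - (h / 2) *: B + (h ^+ 2 / 8) *: (B *m (A + B)).

Definition step_denom (K : numFieldType) (n : nat) (A B : 'M[K]_n) (h : K) :=
  1%:M - h *: B + (h ^+ 2 / 6) *: (B *m (A + B)).

(** The stage approximates exp (h/2 L) to second order.  The h^3 terms cancel as
well, which is why the remainder is a single h^4 term. *)
Lemma stage_denom_mul_taylor (K : numFieldType) (n : nat) (A B : 'M[K]_n)
    (h : K) :
  let L := A + B in
  stage_denom A B h *m (1%:M + (h / 2) *: L + (h ^+ 2 / 8) *: L ^+ 2) =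
  1%:M + (h / 2) *: A + (h ^+ 2 / 8) *: (A *m L)
  + (h ^+ 4 / 64) *: (B *m L ^+ 3).
Proof.
move=> L; rewrite /stage_denom -/L.
have -> : A = L - B by rewrite /L addrK.
clearbody L; clear A.
rewrite !exprS expr0 -!mulmxE !mulmxDl !mulmxDr !mulNmx.
rewrite -!scalemxAl -!scalemxAr !scalerA !mul1mx !mulmx1 !mulmxA.
(* Only the words L^j and B L^j are left; once they are abstract matrices, the
   claim is a scalar identity in each entry. *)
move: L (B *m L) (L *m L) (B *m L *m L) (B *m L *m L *m L).
move=> L BL LL BLL BLLL; apply/matrixP => i j.
by rewrite !mxE; field.
Qed.

(** The order conditions of the base step: with the stage replaced by the Taylor
polynomial of exp (h/2 L), the coefficients of both sides agree through h^4. *)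
Lemma step_denom_mul_taylor (K : numFieldType) (n : nat) (A B : 'M[K]_n)
    (h : K) :
  let L := A + B in
  step_denom A B h *m (\sum_(k < 5) (h ^+ k / k`!%:R) *: L ^+ k) =
  1%:M + h *: A + (h ^+ 2 / 6) *: (A *m L)
  + (h ^+ 2 / 3) *: ((A - B) *m L
      *m (1%:M + (h / 2) *: L + (h ^+ 2 / 8) *: L ^+ 2))
  - h ^+ 5 *: ((1 / 72) *: (B *m L ^+ 4) - (h / 144) *: (B *m L ^+ 5)).
Proof.
move=> L; rewrite /step_denom -/L.
have -> : A = L - B by rewrite /L addrK.
clearbody L; clear A.
rewrite !big_ord_recr big_ord0 /= add0r.
rewrite !exprS expr0 -!mulmxE !mulmxDl !mulmxDr !mulNmx.
rewrite -!scalemxAl -!scalemxAr !scalerA !mul1mx !mulmx1 !mulmxA.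
move: L (B *m L) (L *m L) (B *m L *m L) (L *m L *m L) (B *m L *m L *m L)
 (L *m L *m L *m L) (B *m L *m L *m L *m L) (B *m L *m L *m L *m L *m L).
move=> L BL LL BLL LLL BLLL L4 BL4 BL5.
rewrite !factS fact0; apply/matrixP => i j.
by rewrite !mxE; field.
Qed.

(** The error of the base step divided by h^5.  The first two terms are the
remainder of [step_denom_mul_taylor]; the third is the stage error, where
1/192 = 1/3 * 1/64 comes from the weight h^2/3 of the stage and its error
h^4/64; the last is the tail of the exponential. *)
Definition step_error (K : numFieldType) (n : nat) (A B : 'M[K]_n) (h : K) :=
  let L := A + B in
  invmx (step_denom A B h) *m
    ((1 / 72) *: (B *m L ^+ 4) - (h / 144) *: (B *m L ^+ 5)
     - (h / 192) *:
         ((A - B) *m L *m (invmx (stage_denom A B h) *m (B *m L ^+ 3))))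
  - exp_tail L 5 h.

Lemma Pstar_taylor (K : numFieldType) (n : nat) (A B : 'M[K]_n) (h : K) :
  stage_denom A B h \in unitmx ->
  Pstar h A B =
  1%:M + (h / 2) *: (A + B) + (h ^+ 2 / 8) *: (A + B) ^+ 2
  - (h ^+ 4 / 64) *: (invmx (stage_denom A B h) *m (B *m (A + B) ^+ 3)).
Proof.
move=> unitY; have /(canRL (addrK _)) Z := esym (stage_denom_mul_taylor A B h).
rewrite /Pstar -/(stage_denom A B h) Z mulmxBr mulKmx//.
by rewrite -scalemxAr.
Qed.

Lemma base_step_error (K : numFieldType) (n : nat) (A B : 'M[K]_n) (h : K) :
  exp_complete K ->
  step_denom A B h \in unitmx -> stage_denom A B h \in unitmx ->
  base_step h A B - expmx (h *: (A + B)) = h ^+ 5 *: step_error A B h.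
Proof.
move=> KE unitX unitY; rewrite (@expmx_split K n _ 5 h KE) /step_error.
rewrite /base_step -/(step_denom A B h) (Pstar_taylor unitY).
have := step_denom_mul_taylor A B h => /=.
move: (_ *m (B *m (A + B) ^+ 3)) => Q.
set T4 := \sum_(k < 5) _; set T2 := 1%:M + (h / 2) *: (A + B) + _.
move=> /esym/eqP; rewrite subr_eq => /eqP N2.
rewrite mulmxBr scalerBr addrA N2 -addrA mulmxDr mulKmx//.
rewrite opprD addrACA subrr add0r [in RHS]scalerBr; congr (_ - _).
rewrite [RHS]scalemxAr; congr (_ *m _); rewrite [in RHS]scalerBr; congr (_ - _).
rewrite -scalemxAr !scalerA; congr (_ *: _).
by field.
Qed.

Lemma has_taylor_coefs_denom (K : numFieldType) (n : nat) (B C : 'M[K]_n)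
    (a b : K) (N : nat) :
  has_taylor_coefs (fun h => 1%:M - (h / a) *: B + (h ^+ 2 / b) *: C) N.
Proof.
have cst := fun M : 'M[K]_n => @has_taylor_coefs_cst K _ M N.
apply: has_taylor_coefsD.
  apply: has_taylor_coefsB; first exact: cst.
  exact: (has_taylor_coefs_scaleX 1 a (cst B)).
exact: (has_taylor_coefs_scaleX 2 b (cst C)).
Qed.

Lemma has_taylor_coefs_stage_denom (K : numFieldType) (n : nat)
    (A B : 'M[K]_n) N :
  has_taylor_coefs (stage_denom A B) N.
Proof. exact: has_taylor_coefs_denom. Qed.

Lemma has_taylor_coefs_step_denom (K : numFieldType) (n : nat)
    (A B : 'M[K]_n) N :
  has_taylor_coefs (step_denom A B) N.
Proof.
have -> : step_denom A B =
    fun h => 1%:M - (h / 1) *: B + (h ^+ 2 / 6) *: (B *m (A + B)).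
  by apply/funext => h; rewrite divr1.
exact: has_taylor_coefs_denom.
Qed.

Lemma stage_denom0 (K : numFieldType) (n : nat) (A B : 'M[K]_n) :
  stage_denom A B 0 = 1%:M.
Proof. by rewrite /stage_denom expr0n !mul0r !scale0r subr0 addr0. Qed.

Lemma step_denom0 (K : numFieldType) (n : nat) (A B : 'M[K]_n) :
  step_denom A B 0 = 1%:M.
Proof. by rewrite /step_denom expr0n !mul0r !scale0r subr0 addr0. Qed.

Lemma has_taylor_coefs_step_error (K : numFieldType) (n : nat)
    (A B : 'M[K]_n) N :
  exp_complete K -> has_taylor_coefs (step_error A B) N.
Proof.
move=> KE; have cst := fun M : 'M[K]_n => @has_taylor_coefs_cst K _ M N.
have unitY : stage_denom A B 0 \in unitmx by rewrite stage_denom0 unitmx1.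
have unitX : step_denom A B 0 \in unitmx by rewrite step_denom0 unitmx1.
have YN := has_taylor_coefs_invmx unitY (@has_taylor_coefs_stage_denom K n A B N).
have XN := has_taylor_coefs_invmx unitX (@has_taylor_coefs_step_denom K n A B N).
apply: has_taylor_coefsB; last exact: has_taylor_coefs_exp_tail.
apply: (has_taylor_coefs_mulmx XN).
apply: has_taylor_coefsB.
  apply: has_taylor_coefsB; first exact: cst.
  exact: (has_taylor_coefs_scaleX 1 _ (cst _)).
apply: (has_taylor_coefs_scaleX 1); apply: (has_taylor_coefs_mulmx (cst _)).
exact: (has_taylor_coefs_mulmx YN (cst _)).
Qed.

Lemma near_base_step_error (K : numFieldType) (n : nat) (A B : 'M[K]_n) :
  exp_complete K ->
  \forall h \near (0 : K),
    base_step h A B - expmx (h *: (A + B)) = h ^+ 5 *: step_error A B h.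
Proof.
move=> KE.
have Yc := has_taylor_coefs_continuous (@has_taylor_coefs_stage_denom K n A B 1).
have Xc := has_taylor_coefs_continuous (@has_taylor_coefs_step_denom K n A B 1).
rewrite stage_denom0 in Yc; rewrite step_denom0 in Xc.
have unitY := near_unitmx Yc (unitmx1 _ _).
have unitX := near_unitmx Xc (unitmx1 _ _).
near=> h; apply: base_step_error => //.
  by near: h; exact: unitX.
by near: h; exact: unitY.
Unshelve. all: by end_near. Qed.

Lemma has_taylor_coefs_expmx (K : numFieldType) (n : nat) (L : 'M[K]_n) N :
  exp_complete K -> has_taylor_coefs (fun h : K => expmx (h *: L)) N.
Proof.
move=> KE.
have -> : (fun h : K => expmx (h *: L)) = exp_tail L 0.
  apply/funext => h.
  by rewrite (@expmx_split K n _ 0 h KE) big_ord0 add0r expr0 scale1r.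
exact: has_taylor_coefs_exp_tail.
Qed.

(** The identity of [base_step_error] expresses the base step through functions
already known to be differentiable. *)
Lemma has_taylor_coefs_base_step (K : numFieldType) (n : nat)
    (A B : 'M[K]_n) N :
  exp_complete K -> has_taylor_coefs (fun h => base_step h A B) N.
Proof.
move=> KE.
apply: (@near_eq_has_taylor_coefs _ _
  (fun h => expmx (h *: (A + B)) + h ^+ 5 *: step_error A B h)).
  apply: filterS (near_base_step_error A B KE) => h <-.
  by rewrite addrC subrK.
apply: has_taylor_coefsD; first exact: has_taylor_coefs_expmx.
apply: has_taylor_coefs_scale; last exact: has_taylor_coefs_step_error.
exact: has_taylor_coefsX.
Qed.

(** * Order four of the corrected step *)

Theorem proposition3p3 (R : realType) (kind : scalar_kind)
    (K := scalar_field R kind) (n : nat) (A B0 : 'M[K]_n)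
    (eps0 : K) (Pis Pif : K -> 'M[K]_n)
    (Hsplit : spectral_splitting A B0 eps0 Pis Pif)
    (eps : K) (Heps : 0 < eps <= eps0) :
  [/\ (fun h : K => R_SFRC A B0 Pis Pif h eps - relax_base A B0 h eps)
        =O_ (0 : K) (fun h : K => h ^+ 5),
      (fun h : K => R_SFRC A B0 Pis Pif h eps
                    - expmx (h *: relax_gen A B0 eps))
        =O_ (0 : K) (fun h : K => h ^+ 5)
    & taylor_agree (fun h : K => R_SFRC A B0 Pis Pif h eps)
                   (fun h : K => relax_base A B0 h eps) 4].
Proof.
have KE : exp_complete K := exp_complete_scalar_field R kind.
have sum := splitting_sum Hsplit Heps.
have idem := splitting_slow_idem Hsplit Heps.
have comm := splitting_slow_comm Hsplit Heps.
clearbody K.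
set B := eps^-1 *: B0; set P := Pis eps in sum idem comm *.
set Q := Pif eps in sum *.
pose W := step_error A B; pose E h := expmx (h *: (A + B)).
have SE : \forall h \near (0 : K), base_step h A B - E h = h ^+ 5 *: W h.
  exact: near_base_step_error.
have PE h : P *m E h = E h *m P by exact: comm_mx_expmx.
(* The fast part of the corrected step is exact, so only the slow part of the
   error of the base step survives. *)
have RE h : R_SFRC A B0 Pis Pif h eps - E h = P *m (base_step h A B - E h) *m P.
  rewrite /R_SFRC -/P -/Q /relax_base /relax_gen -/B -/(E h).
  rewrite mulmxBr mulmxBl PE -[E h *m P *m P]mulmxA idem -addrA; congr (_ + _).
  rewrite -[X in _ - X]mulmx1 -sum mulmxDr opprD addrC -addrA addNr addr0//.
have WN N : has_taylor_coefs W N by exact: has_taylor_coefs_step_error.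
have PWPN N : has_taylor_coefs (fun h => P *m W h *m P) N.
  apply: has_taylor_coefs_mulmx; last exact: has_taylor_coefs_cst.
  by apply: has_taylor_coefs_mulmx => //; exact: has_taylor_coefs_cst.
have nearRE : \forall h \near (0 : K),
    R_SFRC A B0 Pis Pif h eps - E h = h ^+ 5 *: (P *m W h *m P).
  by apply: filterS SE => h SEh; rewrite RE SEh -scalemxAr -scalemxAl.
have nearRS : \forall h \near (0 : K),
    R_SFRC A B0 Pis Pif h eps - relax_base A B0 h eps =
    h ^+ 5 *: (P *m W h *m P - W h).
  near=> h; rewrite scalerBr.
  have <- : R_SFRC A B0 Pis Pif h eps - E h = h ^+ 5 *: (P *m W h *m P).
    by near: h; exact: nearRE.
  have <- : base_step h A B - E h = h ^+ 5 *: W h by near: h; exact: SE.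
  by rewrite opprB addrA subrK.
have DN N : has_taylor_coefs (fun h => P *m W h *m P - W h) N.
  exact: has_taylor_coefsB.
have SN N : has_taylor_coefs (fun h => relax_base A B0 h eps) N.
  exact: has_taylor_coefs_base_step.
have RN N : has_taylor_coefs (fun h => R_SFRC A B0 Pis Pif h eps) N.
  apply: has_taylor_coefsD.
    apply: has_taylor_coefs_mulmx; last exact: has_taylor_coefs_cst.
    by apply: has_taylor_coefs_mulmx => //; exact: has_taylor_coefs_cst.
  apply: has_taylor_coefs_mulmx; last exact: has_taylor_coefs_cst.
  exact: has_taylor_coefs_expmx.
split.
- exact: (eqO_scale (has_taylor_coefs_continuous (DN 1%N)) nearRS).
- exact: (eqO_scale (has_taylor_coefs_continuous (PWPN 1%N)) nearRE).
- exact: (taylor_agree_scale (m := 5) _ (RN 4%N) (SN 4%N) (DN 4%N) nearRS).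
Unshelve. all: by end_near. Qed.
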